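(* For every set-indexed family $(f_i:\underline{X}_i\to\underline{Y}_i)_{i\in I}$ of functions between topological spaces, $\operatorname{Lev}^2(\lceil f_i\rceil_{i\in I})=\sup\{\operatorname{Lev}^2(f_i)\mid i\in I\}$.
   Context: For $f:\underline{X}\to\underline{Y}$ define by transfinite recursion $\mathcal{L}^2_0(f)=X$, $\mathcal{L}^2_{\alpha+1}(f)=cl\{x\in\mathcal{L}^2_\alpha(f)\mid f|_{\mathcal{L}^2_\alpha(f)}\text{ is discontinuous at }x\}$ (subspace topology; closure in $X$), and $\mathcal{L}^2_\gamma(f)=cl\bigcap_{\alpha<\gamma}\mathcal{L}^2_\alpha(f)$ for limit $\gamma$. $\operatorname{Lev}^2(f)=\min\{\alpha\mid\mathcal{L}^2_\alpha(f)=\emptyset\}$; if no such $\alpha$ exists the Level is regarded as a value greater than all ordinals (and a supremum involving it equals it). The coproduct $\coprod_i\underline{X}_i=\bigcup_i\{i\}\times X_i$ carries the smallest topology containing all $\{i\}\times U$, $U$ open in $\underline{X}_i$, and $\lceil f_i\rceil_{i\in I}:\coprod_i\underline{X}_i\to\coprod_i\underline{Y}_i$ is $(i,x)\mapsto(i,f_i(x))$. *)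

(* Defs.v *)
From HB Require Import structures.
From mathcomp Require Import all_boot all_classical topology.

Set Implicit Arguments.
Unset Strict Implicit.
Unset Printing Implicit Defensive.

Local Open Scope classical_set_scope.

(* The tree tnode A h denotes the ordinal sup_x (h x + 1); tle and tlt compare
   the denoted ordinals.  The ranks of all well-founded relations on types in
   the universe of A are obtained in this way, and in particular all ordinals
   that can be the level of a function on such a type. *)
Inductive tree : Type := tnode (A : Type) of (A -> tree).

Fixpoint tle (a b : tree) : Prop :=
  match a, b with
  | @tnode A f, @tnode B g => forall x : A, exists y : B, tle (f x) (g y)
  end.

Definition tlt (a b : tree) : Prop :=
  match b with @tnode B g => exists y : B, tle a (g y) end.

Definition teq (a b : tree) : Prop := tle a b /\ tle b a.

Lemma tle_refl a : tle a a.
Proof. by elim: a => A f IH /= x; exists x. Qed.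

Lemma tle_trans a b c : tle a b -> tle b c -> tle a c.
Proof.
elim: a b c => A f IH [B g] [C h] /= ab bc x.
have [y xy] := ab x; have [z yz] := bc y.
by exists z; apply: IH xy yz.
Qed.

Lemma tle_lt_trans a b c : tle a b -> tlt b c -> tlt a c.
Proof. by case: c => C h ab [z bz]; exists z; apply: tle_trans bz. Qed.

Lemma tlt_le_trans a b c : tlt a b -> tle b c -> tlt a c.
Proof.
case: b c => [B g] [C h] [y ay] /(_ y)[z yz].
by exists z; apply: tle_trans yz.
Qed.

Lemma tle_lt_total a b : tle a b \/ tlt b a.
Proof.
elim: a b => A f IH [B g]; have [|nle] := pselect (tle (tnode f) (tnode g)).
  by left.
right; move: nle => /= /existsNP[x /forallNP nx]; exists x.
have lt y : tlt (g y) (f x) by case: (IH x (g y)) => // /nx.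
by case: (f x) lt.
Qed.

Lemma tltW a b : tlt a b -> tle a b.
Proof.
suff H c : match c with @tnode C h => forall z, tle (h z) c end.
  by case: b => B g [y ay]; apply: tle_trans ay (H (tnode g) y).
elim: c => C h IH z.
have := IH z; case E : (h z) => [D k] /= Hk w.
by exists z; rewrite E; apply: Hk.
Qed.

Lemma tlt_wf : well_founded tlt.
Proof.
suff H a b : tle b a -> Acc tlt b by move=> a; apply: H (tle_refl a).
elim: a b => A f IH b ba; constructor => c cb.
by have [x] := tlt_le_trans cb ba; apply: IH.
Qed.

Lemma tlt_irrefl a : ~ tlt a a.
Proof. by elim/(well_founded_ind tlt_wf): a => a IH aa; apply: (IH a). Qed.

(* An ordinal is an equivalence class of trees denoting the same ordinal, so
   that Leibniz equality on Ord is equality of ordinals. *)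
Record Ord : Type := MkOrd {
  ocls : tree -> Prop ;
  ocls_ex : exists a, ocls = teq a }.

Definition oclass (a : tree) : Ord := MkOrd (ex_intro _ a erefl).

Definition orepr (a : Ord) : tree := sval (cid (ocls_ex a)).

Definition ole (a b : Ord) : Prop := tle (orepr a) (orepr b).

Definition olt (a b : Ord) : Prop := tlt (orepr a) (orepr b).

Lemma orepr_class t : teq (orepr (oclass t)) t.
Proof.
rewrite /orepr; case: cid => s /= E; rewrite -E; split; exact: tle_refl.
Qed.

Lemma ole_anti a b : ole a b -> ole b a -> a = b.
Proof.
rewrite /ole /orepr; case: cid; case: cid.
case: a b => [P hP] [Q hQ] /= s EQ t EP ts st.
suff PQ : P = Q by move: hP hQ; rewrite PQ => hP hQ; congr MkOrd.
rewrite EP EQ; apply/funext => u; apply/propext; split=> -[xu ux]; split;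
  by [apply: tle_trans xu | apply: tle_trans ux _].
Qed.

Lemma ole_refl a : ole a a.
Proof. exact: tle_refl. Qed.

Lemma ole_trans b a c : ole a b -> ole b c -> ole a c.
Proof. exact: tle_trans. Qed.

Lemma ole_lt_trans b a c : ole a b -> olt b c -> olt a c.
Proof. exact: tle_lt_trans. Qed.

Lemma olt_le_trans b a c : olt a b -> ole b c -> olt a c.
Proof. exact: tlt_le_trans. Qed.

Lemma ole_lt_total a b : ole a b \/ olt b a.
Proof. exact: tle_lt_total. Qed.

Lemma oltW a b : olt a b -> ole a b.
Proof. exact: tltW. Qed.

Lemma olt_irrefl a : ~ olt a a.
Proof. exact: tlt_irrefl. Qed.

Lemma olt_wf : well_founded olt.
Proof.
suff H t a : orepr a = t -> Acc olt a by move=> a; exact: H.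
elim/(well_founded_ind tlt_wf): t a => t IH a E; constructor => b ba.
by apply: (IH (orepr b)) => //; rewrite -E.
Qed.

Lemma ord_least_ex (P : Ord -> Prop) :
  (exists a, P a) -> exists a, P a /\ forall b, P b -> ole a b.
Proof.
case; elim/(well_founded_ind olt_wf) => a IH Pa.
have [[b [ba Pb]]|nb] := pselect (exists b, olt b a /\ P b).
  exact: IH Pb.
by exists a; split=> // b Pb; case: (ole_lt_total a b) => // ba; case: nb; exists b.
Qed.

Definition ozero : Ord :=
  oclass (tnode (fun x : Empty_set => match x with end)).

Definition osucc (a : Ord) : Ord := oclass (tnode (fun _ : unit => orepr a)).

Definition olimit (a : Ord) : Prop := a <> ozero /\ forall b, a <> osucc b.

Lemma ozero_le a : ole ozero a.
Proof. by apply: tle_trans (orepr_class _).1 _ => /=; case: (orepr a). Qed.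

Lemma olt_osucc a b : olt b (osucc a) <-> ole b a.
Proof.
have [h1 h2] := orepr_class (tnode (fun _ : unit => orepr a)).
split=> [ba|ba]; first by have [_] := tlt_le_trans ba h1.
by apply: tlt_le_trans h2; exists tt.
Qed.

Lemma osucc_inj : injective osucc.
Proof.
by move=> a b e; apply: ole_anti; apply/olt_osucc; [rewrite -e|rewrite e];
  apply/olt_osucc; exact: ole_refl.
Qed.

Lemma osucc_neq0 a : osucc a <> ozero.
Proof.
move=> e; have : olt a ozero by rewrite -e; apply/olt_osucc; exact: ole_refl.
by move=> h; apply: (@olt_irrefl a); apply: olt_le_trans h (ozero_le a).
Qed.

Inductive level : Type := Fin of Ord | Infty.

Definition lle (u v : level) : Prop :=
  match u, v with
  | Fin a, Fin b => ole a b
  | _, Infty => True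
  | Infty, Fin _ => False
  end.

Definition is_lsup (I : Type) (u : I -> level) (s : level) : Prop :=
  (forall i, lle (u i) s) /\ (forall t, (forall i, lle (u i) t) -> lle s t).

Lemma lle_anti u v : lle u v -> lle v u -> u = v.
Proof. by case: u v => [a|] [b|] //= ab ba; rewrite (ole_anti ab ba). Qed.

Lemma ord_bounded (I : Type) (u : I -> Ord) : exists b, forall i, ole (u i) b.
Proof.
exists (oclass (tnode (fun i => orepr (u i)))) => i; apply: tltW.
by apply: tlt_le_trans (orepr_class _).2; exists i; exact: tle_refl.
Qed.

Lemma lsup_ex (I : Type) (u : I -> level) : exists s, is_lsup u s.
Proof.
have [[i ui]|nu] := pselect (exists i, u i = Infty).
  exists Infty; split=> [j|t /(_ i)]; last by rewrite ui; case: t.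
  by case: (u j).
have hu i : exists a, u i = Fin a.
  by case E : (u i) => [a|]; [exists a | case: nu; exists i].
have [|s [su sl]] := @ord_least_ex (fun b => forall i, lle (u i) (Fin b)).
  have [b ub] := ord_bounded (fun i => sval (cid (hu i))).
  by exists b => i; have := ub i; case: cid => a /= ->.
exists (Fin s); split=> // -[b|//]; exact: sl.
Qed.

Definition lsup (I : Type) (u : I -> level) : level := sval (cid (lsup_ex u)).

Lemma lsupP (I : Type) (u : I -> level) : is_lsup u (lsup u).
Proof. by rewrite /lsup; case: cid. Qed.

Section Level2.
Variables (X Y : topologicalType) (f : X -> Y).

Definition discontinuity (A : set X) : set X :=
  [set x | A x /\ ~ {for (x : subspace A), continuous (from_subspace A f)}].

Definition L2_step (a : Ord) (L : forall b, olt b a -> set X) : set X :=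
  [set x | [\/ a = ozero,
     exists b (ba : olt b a),
       a = osucc b /\ closure (discontinuity (L b ba)) x
   | olimit a /\ closure [set y | forall b (ba : olt b a), L b ba y] x]].

Definition L2 : Ord -> set X := Fix olt_wf (fun _ => set X) L2_step.

Lemma L2E a : L2 a = L2_step (fun b (_ : olt b a) => L2 b).
Proof.
rewrite /L2 Fix_eq// => {}a L L' LL'; congr L2_step.
by apply/functional_extensionality_dep => b; apply/funext => ba; exact: LL'.
Qed.

Lemma L2_zero : L2 ozero = setT.
Proof. by rewrite L2E; apply/seteqP; split=> // x _; constructor. Qed.

Lemma L2_succ a : L2 (osucc a) = closure (discontinuity (L2 a)).
Proof.
rewrite L2E; apply/seteqP; split=> x /=.
  case=> [/osucc_neq0//|[b [_ [/osucc_inj <-]]]//|[[_ /(_ a)]]//].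
by move=> cx; constructor 2; exists a; (unshelve eexists) => //;
  apply/olt_osucc; exact: ole_refl.
Qed.

Lemma L2_limit a : olimit a ->
  L2 a = closure [set x | forall b, olt b a -> L2 b x].
Proof.
move=> la; rewrite L2E; apply/seteqP; split=> x /= cx; last by constructor 3.
by case: la cx => a0 aS [/a0//|[b [_ [/aS]]]//|[]].
Qed.

Definition Lev2 : level :=
  match pselect (exists a, L2 a = set0) with
  | left h => Fin (sval (cid (ord_least_ex h)))
  | right _ => Infty
  end.

End Level2.

Definition coprod_map (I : Type) (X Y : I -> Type) (f : forall i, X i -> Y i)
    (z : {i & X i}) : {i & Y i} :=
  existT Y (projT1 z) (f (projT1 z) (projT2 z)).

(* The library topology on {i & X i} makes U open iff every section of U is
   open; with existT_open_map, this shows that it is the smallest topology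
   containing all existT X i @` V, V open. *)
Lemma sigT_open_smallest (I : choiceType) (X : I -> topologicalType)
    (T : set (set {i & X i})) :
  (forall (J : Type) (F : J -> set {i & X i}),
     (forall j, T (F j)) -> T (\bigcup_j F j)) ->
  (forall i (V : set (X i)), open V -> T (existT X i @` V)) ->
  forall U : set {i & X i}, open U -> T U.
Proof.
move=> TU TV U /sigT_openP oU.
have -> : U = \bigcup_i (existT X i @` (existT X i @^-1` U)).
  apply/seteqP; split=> [[i x] Ux|z [i _ [x Ux <-]]//].
  by exists i => //; exists x.
by apply: TU => i; exact: TV.
Qed.

(* Main.v *)
Require Import Defs.
From mathcomp Require Import all_boot all_classical topology.

Set Implicit Arguments.
Unset Strict Implicit.
Unset Printing Implicit Defensive.

Local Open Scope classical_set_scope.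

(** Closures and points of discontinuity are local, so [L2] commutes with
    pulling back along a continuous open map, provided the codomains are
    compared by an open embedding.  Since [L2] decreases, a level is at most
    [a] exactly when [L2] is empty at [a]; hence the level of a map is the
    supremum of the levels of its pieces on any open cover, and the summands
    form an open cover of the coproduct. *)

Lemma ole_eqVlt a b : ole a b -> a = b \/ olt a b.
Proof.
move=> ab; have [ba|] := ole_lt_total b a; last by right.
by left; exact: ole_anti.
Qed.

Lemma olt_ozero a : ~ olt a ozero.
Proof. by move=> a0; exact: olt_irrefl (olt_le_trans a0 (ozero_le a)). Qed.

Lemma transfinite_ind (P : Ord -> Prop) :
  P ozero ->
  (forall a, P a -> P (osucc a)) ->
  (forall a, olimit a -> (forall b, olt b a -> P b) -> P a) ->
  forall a, P a.
Proof.
move=> P0 PS Plim; elim/(well_founded_ind olt_wf) => a IH.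
have [->//|a0] := pselect (a = ozero).
have [[b ab]|nS] := pselect (exists b, a = osucc b).
  by rewrite ab; apply/PS/IH; rewrite ab; apply/olt_osucc; exact: ole_refl.
by apply: Plim => //; split=> // b ab; apply: nS; exists b.
Qed.

Lemma lle_trans v u w : lle u v -> lle v w -> lle u w.
Proof. by case: u v w => [a|] [b|] [c|] //=; exact: ole_trans. Qed.

Lemma eq_level u v :
  (forall a, lle u (Fin a) <-> lle v (Fin a)) -> u = v.
Proof.
case: u v => [a|] [b|] uv //.
- by apply: lle_anti; apply/uv; exact: ole_refl.
- by case: (uv a).1 => /=; exact: ole_refl.
- by case: (uv b).2 => /=; exact: ole_refl.
Qed.

Lemma lsup_leP (I : Type) (u : I -> level) t :
  lle (lsup u) t <-> forall i, lle (u i) t.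
Proof.
have [ub least] := lsupP u; split=> [st i|]; last exact: least.
exact: lle_trans (ub i) st.
Qed.

(* Continuity of [j] is one inclusion, openness the other. *)
Definition continuous_open_map (X Z : topologicalType) (j : X -> Z) : Prop :=
  forall x, nbhs (j x) = j @ nbhs x.

Lemma closure_preimage (X Z : topologicalType) (j : X -> Z) (A : set Z) :
  continuous_open_map j -> j @^-1` closure A = closure (j @^-1` A).
Proof.
move=> jE; apply/seteqP; split=> x /= clx V xV.
- have /clx[z [/[swap]-[y Vy <-] Ay]] : nbhs (j x) (j @` V).
    by rewrite jE; apply: filterS xV; exact: preimage_image.
  by exists y.
- by move: xV; rewrite jE => /clx[y [Ay Vy]]; exists (j y).
Qed.

Lemma open_embedding_cvgP (Y W : topologicalType) (k : Y -> W)
    (F : set_system Y) y :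
  Filter F -> continuous_open_map k -> injective k ->
  k @ F --> k y <-> F --> y.
Proof.
move=> FF kE kI; rewrite kE; split=> [kFy V yV|Fy V /Fy//].
have FkV : F (k @^-1` (k @` V)).
  by apply: kFy; apply: filterS yV; exact: preimage_image.
by apply: filterS FkV => x [x' Vx' /kI <-].
Qed.

Lemma subspace_continuous_atP (X Y : topologicalType) (f : X -> Y)
    (A : set X) x : A x ->
  {for (x : subspace A), continuous (from_subspace A f)} <->
  f @ within A (nbhs x) --> f x.
Proof. by move=> Ax; rewrite nbhs_subspace_in. Qed.

Section L2Theory.
Variables (X Y : topologicalType) (f : X -> Y).

Lemma L2_closed a : closed (L2 f a).
Proof.
elim/transfinite_ind: a => [|a _|a alim _].
- by rewrite L2_zero; exact: closedT.
- by rewrite L2_succ; exact: closed_closure.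
- by rewrite L2_limit//; exact: closed_closure.
Qed.

Lemma L2_antitone a b : ole a b -> L2 f b `<=` L2 f a.
Proof.
elim/transfinite_ind: b => [|b IH|b blim _] /ole_eqVlt[->//|ab].
- by case: (olt_ozero ab).
- rewrite L2_succ closureE; apply: smallest_sub; first exact: L2_closed.
  by move=> x [bx _]; apply: IH => //; apply/olt_osucc.
- rewrite L2_limit// closureE; apply: smallest_sub; first exact: L2_closed.
  by move=> x; exact.
Qed.

Lemma Lev2_leP a : lle (Lev2 f) (Fin a) <-> L2 f a = set0.
Proof.
rewrite /Lev2; case: pselect => [ex|nex]; last first.
  by split=> // a0; case: nex; exists a.
case: cid => b [b0 bmin] /=; split=> [ba|]; last exact: bmin.
by rewrite -subset0 -b0; exact: L2_antitone.
Qed.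

End L2Theory.

Section Pullback.
Variables (X Y Z W : topologicalType) (f : X -> Y) (g : Z -> W).
Variables (j : X -> Z) (k : Y -> W).
Hypotheses (j_open : continuous_open_map j) (k_open : continuous_open_map k).
Hypotheses (k_inj : injective k) (gj : forall x, g (j x) = k (f x)).

Lemma subspace_continuous_at_preimage (A : set Z) x : A (j x) ->
  {for (j x : subspace A), continuous (from_subspace A g)} <->
  {for (x : subspace (j @^-1` A)),
    continuous (from_subspace (j @^-1` A) f)}.
Proof.
move=> Ax; rewrite !subspace_continuous_atP// j_open gj.
have -> : g @ within A (j @ nbhs x) = k @ (f @ within (j @^-1` A) (nbhs x)).
  by rewrite -fmap_comp -(funext gj : g \o j = k \o f).
exact: open_embedding_cvgP.
Qed.

Lemma discontinuity_preimage (A : set Z) :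
  j @^-1` discontinuity g A = discontinuity f (j @^-1` A).
Proof.
by apply/seteqP; split=> x [Ax dx]; split=> //;
  apply: contra_not dx => /(subspace_continuous_at_preimage Ax).
Qed.

Lemma L2_preimage a : j @^-1` L2 g a = L2 f a.
Proof.
elim/transfinite_ind: a => [|a IH|a alim IH].
- by rewrite !L2_zero.
- by rewrite !L2_succ closure_preimage// discontinuity_preimage IH.
- rewrite !L2_limit// closure_preimage//; congr closure.
  by apply/seteqP; split=> x /= ax b ba; have := ax b ba; rewrite -IH.
Qed.

End Pullback.

Lemma Lev2_open_cover (I : Type) (X Y : I -> topologicalType)
    (Z W : topologicalType) (f : forall i, X i -> Y i) (g : Z -> W)
    (j : forall i, X i -> Z) (k : forall i, Y i -> W) :
  (forall i, continuous_open_map (j i)) ->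
  (forall i, continuous_open_map (k i)) ->
  (forall i, injective (k i)) ->
  (forall i x, g (j i x) = k i (f i x)) ->
  (forall z, exists i x, z = j i x) ->
  Lev2 g = lsup (fun i => Lev2 (f i)).
Proof.
move=> j_open k_open k_inj gj cover.
have L2j i a : j i @^-1` L2 g a = L2 (f i) a by exact: L2_preimage (gj i) a.
apply: eq_level => a; rewrite lsup_leP Lev2_leP; split=> [g0 i|f0].
  by apply/Lev2_leP; rewrite -L2j g0 preimage_set0.
rewrite -subset0 => z; have [i [x ->]] := cover z.
have /Lev2_leP fi0 := f0 i.
suff : ~ (j i @^-1` L2 g a) x by [].
by rewrite L2j fi0.
Qed.

Lemma existT_continuous_open (I : choiceType) (X : I -> topologicalType) i :
  continuous_open_map (existT X i).
Proof. by move=> x; exact: sigT_nbhsE. Qed.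

Theorem theorem5p14 (I : choiceType) (X Y : I -> topologicalType)
    (f : forall i, X i -> Y i) :
  Lev2 (coprod_map f : {i & X i} -> {i & Y i}) = lsup (fun i => Lev2 (f i)).
Proof.
apply: (@Lev2_open_cover _ _ _ _ _ _ _ (existT X) (existT Y)) => //.
- by move=> i y z; exact: eq_from_Tagged.
- by move=> [i x]; exists i, x.
Qed.
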